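(* Let $m$ be the probability measure driven by a Markov chain on $\mathcal{S}=\{0,1,\dots,\ell-1\}$ with initial distribution $(p_i)_{i\in\mathcal{S}}$ and transition matrix $P=(p_{ij})_{i,j\in\mathcal{S}}$, and suppose that $P$ is irreducible. For $q\in\mathbb{R}$, let $\lambda_q$ be the spectral radius of the matrix $P_q=(p_{ij}^q)_{i,j\in\mathcal{S}}$. Then for every $q\in\mathbb{R}$ the structure function $$\tau(q)=\limsup_{n\to\infty}\frac{1}{n\log\ell}\log\Big(\sum_{I\in\mathcal{F}_n}m(I)^q\Big)$$ satisfies $\tau(q)=\log_\ell(\lambda_q)$, and the upper limit defining $\tau(q)$ is in fact a limit.
   Context: Let $\ell\ge 2$ be an integer and $\mathcal{S}=\{0,1,\dots,\ell-1\}$. For $n\ge1$ and a word $\varepsilon_1\cdots\varepsilon_n\in\mathcal{S}^n$ let $I_{\varepsilon_1\cdots\varepsilon_n}=\big[\sum_{i=1}^n\varepsilon_i\ell^{-i},\ \sum_{i=1}^n\varepsilon_i\ell^{-i}+\ell^{-n}\big)$; $\mathcal{F}_n$ is the set of these $\ell$-adic intervals of order $n$. A probability vector $(p_i)_{i\in\mathcal{S}}$ (initial distribution) and a stochastic matrix $P=(p_{ij})_{i,j\in\mathcal{S}}$ (transition matrix) are given; it is always assumed that $p_{ij}\neq 1$ for all $i,j\in\mathcal{S}$. The measure driven by the corresponding Markov chain is the unique Borel probability measure $m$ carried by $[0,1)$ with $m(I_{\varepsilon_1\cdots\varepsilon_n})=p_{\varepsilon_1}p_{\varepsilon_1\varepsilon_2}\cdots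 p_{\varepsilon_{n-1}\varepsilon_n}$ for all words. $P$ is irreducible if for all $i,j\in\mathcal{S}$ there is $n\ge1$ with $(P^n)_{ij}>0$. Convention: $0^q=0$ for every $q\in\mathbb{R}$ (including $q\le 0$), both in $P_q$ and in sums of $m(I)^q$. *)

(* Defs.v *)
From mathcomp Require Import all_boot all_order all_algebra.
From mathcomp Require Import complex.
From mathcomp Require Import all_classical all_reals all_analysis.

Set Implicit Arguments.
Unset Strict Implicit.
Unset Printing Implicit Defensive.

Import Order.TTheory GRing.Theory Num.Theory.
Import numFieldNormedType.Exports.

Local Open Scope classical_set_scope.
Local Open Scope ring_scope.

Section LadicIntervals.
Context (R : realType) (l : nat).

Definition ladic_left n (w : n.-tuple 'I_l) : R :=
  \sum_(i < n) (tnth w i)%:R / l%:R ^+ i.+1.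

Definition ladic_interval n (w : n.-tuple 'I_l) : set R :=
  `[ladic_left w, ladic_left w + (l%:R ^+ n)^-1[.

Definition ladic_family n : set (set R) :=
  range (fun w : n.-tuple 'I_l => ladic_interval w).

End LadicIntervals.

Arguments ladic_family : clear implicits.

Section MarkovChain.
Context (R : realType) (l : nat).
Implicit Types (p : 'rV[R]_l) (P : 'M[R]_l).

Definition probability_vector p :=
  (forall i, 0 <= p 0 i) /\ \sum_i p 0 i = 1.

Definition stochastic_matrix P :=
  (forall i j, 0 <= P i j) /\ (forall i, \sum_j P i j = 1).

Definition irreducible_matrix P :=
  forall i j, exists2 n, (1 <= n)%N & 0 < (P ^+ n) i j.

Definition word_weight p P n (w : n.+1.-tuple 'I_l) : R :=
  p 0 (tnth w ord0) *
  \prod_(i < n) P (tnth w (widen_ord (leqnSn n) i)) (tnth w (lift ord0 i)).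

(* The index [n.+1] restricts to nonempty words; the prescribed values determine
   [m], since the l-adic intervals generate the Borel sets of [0, 1). *)
Definition driven_by (m : probability (measurableTypeR R) R) p P :=
  m (`[0, 1[%classic : set R) = 1%E /\
  forall n (w : n.+1.-tuple 'I_l),
    m (ladic_interval w : set R) = (word_weight p P w)%:E.

End MarkovChain.

(* Unlike [powR], for which [0 `^ 0 = 1], this power satisfies [0^q = 0] for
   every [q]. *)
Definition pow0R (R : realType) (x q : R) : R := if x == 0 then 0 else x `^ q.

Definition spectral_radius (R : realType) (n : nat) (A : 'M[R]_n) : R :=
  sup [set Normc.normc z |
        z in [set z : R[i] | eigenvalue (map_mx (real_complex R) A) z]].

Definition logb (R : realType) (b x : R) : R := ln x / ln b.

Section StructureFunction.
Context (R : realType) (l : nat) (m : probability (measurableTypeR R) R).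

(* The value at [n = 0], where the denominator vanishes, is irrelevant to the
   limits taken below. *)
Definition structure_seq (q : R) (n : nat) : R :=
  (n%:R * ln l%:R)^-1 *
  ln (\sum_(I \in ladic_family R l n) pow0R (fine (m I)) q).

Definition structure_function (q : R) : \bar R :=
  limn_esup (fun n => (structure_seq q n)%:E).

End StructureFunction.

(* Main.v *)
(* Writing A = P_q and a = (p_i^q), the structure sum at level n+1 is
   \sum_j (a A^n)_j.  If A u = r u with u > 0 entrywise, then 1 lies between two
   positive multiples of u, so this sum lies between two positive multiples of
   r^n, and its normalized logarithm tends to log_l r.  The vector u comes from
   maximizing t over the compact set of pairs (x, t), x in the simplex, with
   t x <= x A^T; pairing |w| with u for a complex left eigenvector w shows that
   every eigenvalue of A has modulus at most r. *)

Require Import Defs.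
From mathcomp Require Import all_boot all_order all_algebra.
From mathcomp Require Import complex.
From mathcomp Require Import all_classical all_reals all_analysis.
From mathcomp Require Import ring.
Set Implicit Arguments.
Unset Strict Implicit.
Unset Printing Implicit Defensive.

Import Order.TTheory GRing.Theory Num.Theory.
Import numFieldNormedType.Exports.
Local Open Scope classical_set_scope.
Local Open Scope ring_scope.

(** * Positive eigenvectors of irreducible nonnegative matrices *)

Lemma finite_pos_lower_bound (R : realType) (T : finType) (f : T -> R) :
  (forall i, 0 < f i) -> exists2 e : R, 0 < e & forall i, e <= f i.
Proof.
(* The default [1] keeps the minimum positive even when [T] is empty. *)
move=> f0; exists (\big[Num.min/1]_i f i); last by move=> i; exact: bigmin_le_cond.
by apply: lt_bigmin => // i _.
Qed.

Section Perron.
Context (R : realType) (n : nat).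
Implicit Types (A B : 'M[R]_n) (x : 'rV[R]_n) (i j : 'I_n).

Lemma mulmx_row_pos x B : (forall i, 0 <= x 0 i) -> x != 0 ->
  (forall i j, 0 < B i j) -> forall j, 0 < (x *m B) 0 j.
Proof.
move=> x0 /rV0Pn[k xk] B0 j; rewrite mxE (bigD1 k) //=.
rewrite ltr_wpDr ?mulr_gt0 ?sumr_ge0// => [i _|].
  by rewrite mulr_ge0// ltW.
by rewrite lt0r xk x0.
Qed.

(* The value [r] in the maximizing pair is the Collatz-Wielandt number. *)
Lemma collatz_wielandt_attained A : (0 < n)%N -> (forall i j, 0 <= A i j) ->
  exists (x : 'rV[R]_n) (r : R), [/\ 0 <= r, x != 0, forall i, 0 <= x 0 i,
    forall i, r * x 0 i <= (x *m A) 0 i &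
    forall (y : 'rV[R]_n) (t : R), y != 0 -> (forall i, 0 <= y 0 i) -> 0 <= t ->
      (forall i, t * y 0 i <= (y *m A) 0 i) -> t <= r].
Proof.
move=> n0 A0; set M : R := \sum_i \sum_j A i j.
(* [D] is a compact box and [C] a closed set. Their intersection consists of the pairs [(y, t)] with
   [y] in the simplex, [t y <= y A] and [0 <= t <= M]. *)
pose D : set ('rV[R]_n * R) :=
  [set v : 'rV[R]_n | forall i, `[0, 1]%classic (v 0 i)] `*` `[0, M]%classic.
pose C : set ('rV[R]_n * R) :=
  [set y : 'rV[R]_n * R | \sum_i y.1 0 i = 1] `&`
  \bigcap_(i in setT) [set y : 'rV[R]_n * R | 0 <= (y.1 *m A) 0 i - y.2 * y.1 0 i].
have cD : compact D.
  apply: compact_setX; last exact: segment_compact.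
  by apply: (@rV_compact R n (fun=> `[0, 1]%classic)) => _; exact: segment_compact.
have coord i : continuous (fun y : 'rV[R]_n * R => y.1 0 i).
  move=> y; apply: (@continuous_comp _ _ _ fst (fun M : 'rV[R]_n => M 0 i)).
    exact: cvg_fst.
  exact: coord_continuous.
have cC : closed C.
  apply: closedI.
    apply: (@preimage_closed _ _ (fun y : 'rV[R]_n * R => \sum_i y.1 0 i) [set 1]).
      by move=> y _; apply: cvg_big => [|i _]; [exact: add_continuous|exact: coord].
    exact: closed_eq.
  apply: closed_bigI => i _.
  apply: (@preimage_closed _ _
    (fun y : 'rV[R]_n * R => (y.1 *m A) 0 i - y.2 * y.1 0 i) [set t | 0 <= t]).
    move=> y _; apply: cvgB; last by apply: cvgM; [exact: cvg_snd|exact: coord].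
    under eq_fun do rewrite mxE.
    rewrite mxE; apply: cvg_big => [|j _]; first exact: add_continuous.
    by apply: cvgM; [exact: coord|exact: cvg_cst].
  exact: closed_ge.
(* The condition [t y <= y A] is homogeneous in [y], so any competitor can be rescaled into the
   simplex with the same [t]. *)
have norm (y : 'rV[R]_n) (t : R) : y != 0 -> (forall i, 0 <= y 0 i) -> 0 <= t ->
    (forall i, t * y 0 i <= (y *m A) 0 i) -> exists z, (D `&` C) (z, t).
  move=> yn0 y0 t0 yt; set s := \sum_i y 0 i.
  have s0 : 0 < s.
    have /rV0Pn[k yk] := yn0; rewrite /s (bigD1 k)//= ltr_wpDr ?sumr_ge0//.
    by rewrite lt0r yk y0.
  exists (s^-1 *: y).
  have zE i : (s^-1 *: y) 0 i = s^-1 * y 0 i by rewrite mxE.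
  have z1 : \sum_i (s^-1 *: y) 0 i = 1.
    under eq_bigr do rewrite zE.
    by rewrite -mulr_sumr mulVf// gt_eqF.
  have z0 i : 0 <= (s^-1 *: y) 0 i by rewrite zE mulr_ge0// invr_ge0 ltW.
  have zle i : (s^-1 *: y) 0 i <= 1.
    by rewrite -z1 (bigD1 i)//= lerDl sumr_ge0.
  have zt i : t * (s^-1 *: y) 0 i <= (s^-1 *: y *m A) 0 i.
    by rewrite zE -scalemxAl mxE mulrCA ler_wpM2l// invr_ge0 ltW.
  split; split => //=.
  - by move=> i; rewrite in_itv/= z0 zle.
  (* The cap [M] excludes no admissible [t]: summing [t z <= z A] over coordinates, with [z] of
     total mass 1 and entries at most 1, gives [t <= M]. *)
  - rewrite in_itv/= t0/= -[t]mulr1 -z1 mulr_sumr.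
    apply: (le_trans (ler_sum _ (fun i _ => zt i))).
    under eq_bigr do rewrite mxE.
    rewrite exchange_big/=; apply: ler_sum => i _; apply: ler_sum => j _.
    by rewrite ler_piMl.
  - by move=> i _ /=; rewrite subr_ge0 zt.
have DC0 : (D `&` C) !=set0.
  have [|i|//|i|z zDC] := norm (const_mx 1) 0; last by exists (z, 0).
  - by apply/rV0Pn; exists (Ordinal n0); rewrite mxE oner_neq0.
  - by rewrite mxE.
  - by rewrite mul0r mxE sumr_ge0// => j _; rewrite mxE mul1r.
have [|[x r] xr max] := @compact_EVT_max _ R snd _ DC0 (compact_closedI cD cC).
  by apply: continuous_subspaceT => y; exact: cvg_snd.
have [[/= xb]] := set_mem xr; rewrite in_itv/= => /andP[r0 _] [/= x1 xA].
exists x, r; split => //.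
- apply: contra_eq_neq x1 => ->.
  by rewrite big1 ?(eq_sym 0) ?oner_neq0// => i _; rewrite mxE.
- by move=> i; have := xb i; rewrite in_itv/= => /andP[].
- by move=> i; rewrite -subr_ge0; exact: xA.
move=> y t yn0 y0 t0 yt; have [z zt] := norm y t yn0 y0 t0 yt.
by have /= := max _ (mem_set zt).
Qed.

(** A polynomial in [A] commutes with [A]. This lets an inequality between [x A] and [r x] be
    transported to [x B] for a sum [B] of powers. *)
Lemma exprmx_comm_sum A (N : 'I_n -> 'I_n -> nat) :
  A *m (\sum_i \sum_j A ^+ N i j) = (\sum_i \sum_j A ^+ N i j) *m A.
Proof.
rewrite mulmx_sumr mulmx_suml; apply: eq_bigr => i _.
rewrite mulmx_sumr mulmx_suml; apply: eq_bigr => j _.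
by have := commrX (N i j) (commr_refl A).
Qed.

Lemma exprmx_ge0 A k : (forall i j, 0 <= A i j) -> forall i j, 0 <= (A ^+ k) i j.
Proof.
move=> A0; elim: k => [|k IH] i j; first by rewrite expr0 mxE ler0n.
by rewrite exprS mxE sumr_ge0// => h _; rewrite mulr_ge0.
Qed.

Lemma exprmx_eigen A x r k : x *m A = r *: x -> x *m A ^+ k = r ^+ k *: x.
Proof.
move=> xA; elim: k => [|k IH]; first by rewrite !expr0 mulmx1 scale1r.
by rewrite exprS mulmxA xA -scalemxAl IH scalerA -exprS.
Qed.

(** Irreducibility makes a suitable sum [B] of powers of [A] entrywise positive. If a maximizing
    pair had slack in [r x <= x A], then [B] would make the slack strict in every coordinate and [r]
    could be increased. Positivity of [x] then follows from that of [x B = s x]. *)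
Lemma perron_left A : (0 < n)%N -> (forall i j, 0 <= A i j) ->
  irreducible_matrix A ->
  exists (x : 'rV[R]_n) (r : R), [/\ 0 < r, forall i, 0 < x 0 i & x *m A = r *: x].
Proof.
move=> n0 A0 hA; have [x [r [r0 xn0 x0 xr max]]] := collatz_wielandt_attained n0 A0.
pose N i j := s2val (cid2 (hA i j)).
have N1 i j : (1 <= N i j)%N by rewrite /N; case: cid2.
have Npos i j : 0 < (A ^+ N i j) i j by rewrite /N; case: cid2.
pose B := \sum_i \sum_j A ^+ N i j.
have B0 i j : 0 < B i j.
  rewrite /B summxE (bigD1 i)//= summxE (bigD1 j)//= ltr_wpDr//.
    by rewrite sumr_ge0// => k _; rewrite summxE sumr_ge0// => *; exact: exprmx_ge0.
  by rewrite ltr_wpDr// sumr_ge0// => *; exact: exprmx_ge0.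
have xB0 := mulmx_row_pos x0 xn0 B0.
have xA : x *m A = r *: x.
  apply/eqP; rewrite -subr_eq0; apply/negPn/negP; set y := _ - _ => yn0.
  have y0 i : 0 <= y 0 i by rewrite !mxE subr_ge0; have := xr i; rewrite mxE.
  have yB0 := mulmx_row_pos y0 yn0 B0.
  (* [x B] improves on [x], since [x B A - r x B = (x A - r x) B > 0]. *)
  have [|e e0 He] := @finite_pos_lower_bound R _ (fun i => (y *m B) 0 i / (x *m B) 0 i).
    by move=> i; rewrite divr_gt0.
  (* By the choice of [e], [e (x B) <= y B], hence [(r + e) (x B) <= x B A], contradicting
     maximality of [r]. *)
  suff : r + e <= r by rewrite gerDl leNgt e0.
  apply: (max (x *m B)).
  - by apply/rV0Pn; exists (Ordinal n0); rewrite gt_eqF.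
  - by move=> i; exact: ltW.
  - by rewrite addr_ge0// ltW.
  move=> i; rewrite -mulmxA -exprmx_comm_sum -/B mulmxA mulrDl.
  have -> : x *m A = y + r *: x by rewrite subrK.
  rewrite mulmxDl -scalemxAl [leRHS]mxE [(r *: (x *m B)) 0 i]mxE addrC lerD2l.
  by rewrite -ler_pdivlMr.
pose s := \sum_i \sum_j r ^+ N i j.
have xB : x *m B = s *: x.
  rewrite mulmx_sumr scaler_suml; apply: eq_bigr => i _.
  rewrite mulmx_sumr scaler_suml; apply: eq_bigr => j _.
  exact: exprmx_eigen.
have sx0 i : 0 < s * x 0 i by have := xB0 i; rewrite xB mxE.
exists x, r; split => //.
  (* All exponents [N i j] are at least 1, so [r = 0] would force [s = 0], against [s x > 0]. *)
  rewrite lt0r r0 andbT; apply/negP => /eqP rE; have := sx0 (Ordinal n0).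
  rewrite /s big1 ?mul0r ?ltxx// => i _; rewrite big1// => j _.
  by rewrite rE expr0n; have := N1 i j; case: (N i j).
move=> i; rewrite lt0r x0 andbT; apply/negP => /eqP xi; have := sx0 i.
by rewrite xi mulr0 ltxx.
Qed.

End Perron.

(** * Complex eigenvalues and the spectral radius *)

Lemma normr_eigenvalue_le (R : realType) n (A : 'M[R]_n) (u : 'I_n -> R) r
    (z : R[i]) :
  (forall i j, 0 <= A i j) -> (forall i, 0 < u i) ->
  (forall i, \sum_j A i j * u j = r * u i) ->
  eigenvalue (map_mx (real_complex R) A) z -> Normc.normc z <= r.
Proof.
move=> A0 u0 Au /eigenvalueP[w wA /rV0Pn[k wk]].
pose c := real_complex R.
have c0 x : 0 <= x -> 0 <= c x by move=> x0; rewrite (lecR 0 x).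
have cN x : 0 <= x -> `|c x| = c x by move=> x0; rewrite ger0_norm// c0.
(* [s] is the l1-norm of [w] weighted by [u]. In this norm the triangle inequality applied to
   [w A = z w] gives [|z| s <= r s], because [A u = r u]. *)
pose s := \sum_i `|w 0 i| * c (u i).
have s0 : 0 < s.
  rewrite /s (bigD1 k)//= ltr_wpDr//.
    by rewrite sumr_ge0// => i _; rewrite mulr_ge0// c0// ltW.
  by rewrite mulr_gt0 ?normr_gt0// (ltcR 0 (u k)).
suff : `|z| * s <= c r * s by rewrite ler_pM2r// (lecR (Normc.normc z) r).
have -> : `|z| * s = \sum_j `|\sum_i w 0 i * c (A i j)| * c (u j).
  rewrite mulr_sumr; apply: eq_bigr => j _; rewrite mulrA -normrM; congr (`|_| * _).
  have /rowP/(_ j) := wA; rewrite !mxE => <-.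
  by apply: eq_bigr => i _; rewrite mxE.
have -> : c r * s = \sum_j (\sum_i `|w 0 i * c (A i j)|) * c (u j).
  under [RHS]eq_bigr do rewrite mulr_suml.
  rewrite exchange_big mulr_sumr; apply: eq_bigr => i _ /=.
  rewrite mulrCA -rmorphM -Au rmorph_sum mulr_sumr.
  by apply: eq_bigr => j _; rewrite rmorphM normrM cN// mulrA.
apply: ler_sum => j _; rewrite ler_wpM2r ?c0 ?(ltW (u0 j))//.
exact: ler_norm_sum.
Qed.

(** The left eigenvector [x] makes [r] itself an eigenvalue, and the positive right eigenvector [u]
    makes it an upper bound for all moduli. *)
Lemma spectral_radius_eq (R : realType) n (A : 'M[R]_n) (x : 'rV[R]_n)
    (u : 'I_n -> R) r :
  (forall i j, 0 <= A i j) -> (forall i, 0 < u i) ->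
  (forall i, \sum_j A i j * u j = r * u i) ->
  x != 0 -> x *m A = r *: x -> 0 <= r -> spectral_radius A = r.
Proof.
move=> A0 u0 Au xn0 xA r0; rewrite /spectral_radius; set S := (X in sup X).
have Sr : S r.
  exists (real_complex R r); last by rewrite /= expr0n addr0 sqrtr_sqr ger0_norm.
  apply/eigenvalueP; exists (map_mx (real_complex R) x).
    by rewrite -map_mxM xA map_mxZ.
  by rewrite map_mx_eq0.
have ubS : ubound S r by move=> _ [z /= Sz <-]; exact: normr_eigenvalue_le Sz.
apply/eqP; rewrite eq_le; apply/andP; split.
  by apply: ge_sup => //; exists r.
by apply: ub_le_sup => //; exists r.
Qed.

(** * Powers with [0^q = 0] and sums over words *)

Lemma pow0R_ge0 (R : realType) (x q : R) : 0 <= pow0R x q.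
Proof. by rewrite /pow0R; case: ifP => // _; exact: powR_ge0. Qed.

Lemma pow0R_gt0 (R : realType) (x q : R) : 0 < x -> 0 < pow0R x q.
Proof. by move=> x0; rewrite /pow0R gt_eqF// powR_gt0. Qed.

Lemma pow0RM (R : realType) (x y q : R) : 0 <= x -> 0 <= y ->
  pow0R (x * y) q = pow0R x q * pow0R y q.
Proof.
move=> x0 y0; rewrite /pow0R mulf_eq0; case: eqP => [|_] /=; first by rewrite mul0r.
by case: eqP => [|_]; rewrite ?mulr0// powRM.
Qed.

Lemma pow0R1 (R : realType) (q : R) : pow0R 1 q = 1.
Proof. by rewrite /pow0R oner_eq0 powR1. Qed.

Lemma pow0R_prod (R : realType) (I : Type) (s : seq I) (F : I -> R) (q : R) :
  (forall i, 0 <= F i) ->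
  pow0R (\prod_(i <- s) F i) q = \prod_(i <- s) pow0R (F i) q.
Proof.
move=> F0; elim: s => [|i s IH]; first by rewrite !big_nil pow0R1.
by rewrite !big_cons pow0RM ?IH// prodr_ge0.
Qed.

Lemma sum_tuple_cons (V : nmodType) (T : finType) n (F : n.+1.-tuple T -> V) :
  \sum_w F w = \sum_a \sum_(w : n.-tuple T) F [tuple of a :: w].
Proof.
rewrite pair_bigA /=.
rewrite (reindex (fun v : T * n.-tuple T => [tuple of v.1 :: v.2]))//=.
exists (fun w : n.+1.-tuple T => (thead w, [tuple of behead w])).
  by move=> [a w] _ /=; rewrite theadE; congr pair; apply: val_inj.
by move=> w _; rewrite [RHS]tuple_eta.
Qed.

(** Summing out the first letter replaces the initial vector [a] by [a A], so the induction must
    keep [a] general. *)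
Lemma sum_word_weight (R : realType) l (a : 'rV[R]_l) (A : 'M[R]_l) n :
  \sum_(w : n.+1.-tuple 'I_l) word_weight a A w = \sum_j (a *m A ^+ n) 0 j.
Proof.
elim: n a => [|n IH] a; rewrite sum_tuple_cons.
  rewrite expr0 mulmx1; apply: eq_bigr => i _.
  rewrite (big_pred1 [tuple]) => [|w]; last by rewrite (tuple0 w) /= eqxx.
  by rewrite /word_weight tnth0 big_ord0 mulr1.
rewrite exprS mulmxA -IH exchange_big; apply: eq_bigr => w _ /=.
rewrite /word_weight mxE mulr_suml; apply: eq_bigr => b _.
rewrite big_ord_recl tnth0 !mulrA; congr (_ * _ * _).
  by rewrite tnthS; congr (A _ _).
apply: eq_bigr => i _; rewrite tnthS; congr (A _ _).
by rewrite (_ : widen_ord _ _ = lift ord0 (widen_ord (leqnSn n) i)) ?tnthS//; exact: val_inj.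
Qed.

Lemma pow0R_word_weight (R : realType) l (p : 'rV[R]_l) (P : 'M[R]_l) q n
    (w : n.+1.-tuple 'I_l) :
  (forall i, 0 <= p 0 i) -> (forall i j, 0 <= P i j) ->
  pow0R (word_weight p P w) q =
  word_weight (map_mx (fun x => pow0R x q) p) (map_mx (fun x => pow0R x q) P) w.
Proof.
move=> p0 P0; rewrite /word_weight pow0RM ?prodr_ge0// pow0R_prod// mxE.
by congr (_ * _); apply: eq_bigr => i _; rewrite mxE.
Qed.

(** * Words and l-adic intervals *)

Lemma ladic_left_cons (R : realType) l n (a : 'I_l) (w : n.-tuple 'I_l) :
  ladic_left R [tuple of a :: w] = (a%:R + ladic_left R w) / l%:R.
Proof.
rewrite /ladic_left big_ord_recl tnth0 expr1 mulrDl mulr_suml; congr (_ + _).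
by apply: eq_bigr => i _; rewrite tnthS exprSr invfM mulrA.
Qed.

Lemma ladic_left_bounds (R : realType) l n (w : n.-tuple 'I_l) :
  (0 < l)%N -> 0 <= ladic_left R w < 1.
Proof.
move=> l0; elim: n w => [|n IH] w.
  by rewrite /ladic_left big_ord0 lexx ltr01.
rewrite (tuple_eta w) ladic_left_cons.
have /andP[w0 w1] := IH [tuple of behead w].
rewrite divr_ge0 ?addr_ge0//= ltr_pdivrMr ?ltr0n// mul1r.
have : ((thead w).+1%:R : R) <= l%:R by rewrite ler_nat.
by rewrite -natr1; apply: lt_le_trans; rewrite ltrD2l.
Qed.

(** The first digit is the integer part of [l] times the left endpoint, and the fractional part is
    the left endpoint for the remaining word. *)
Lemma ladic_left_inj (R : realType) l n :
  injective (@ladic_left R l n).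
Proof.
move=> v w; elim: n v w => [|n IH] v w; first by rewrite (tuple0 v) (tuple0 w).
have l0 : (0 < l)%N by exact: leq_ltn_trans (leq0n _) (ltn_ord (thead v)).
rewrite (tuple_eta v) (tuple_eta w) !ladic_left_cons.
set a := thead v; set b := thead w; set v' := [tuple of behead v]; set w' := [tuple of behead w].
move/(divIf (lt0r_neq0 _)); rewrite ltr0n => /(_ l0) vw.
have /andP[v0 v1] := ladic_left_bounds R v' l0.
have /andP[w0 w1] := ladic_left_bounds R w' l0.
have le (c d : nat) (s t : R) : c%:R + s = d%:R + t -> 0 <= t -> s < 1 -> (d <= c)%N.
  move=> cd t0 s1; rewrite -ltnS -(ltr_nat R) -natr1.
  by rewrite (@le_lt_trans _ _ (d%:R + t)) ?lerDl// -cd ltrD2l.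
have ab : a = b.
  by apply/val_inj/eqP; rewrite eqn_leq (le _ _ _ _ vw)// (le _ _ _ _ (esym vw)).
move: vw; rewrite ab => /addrI/IH vw.
by apply: val_inj => /=; congr cons; exact: (congr1 (@tval _ _) vw).
Qed.

(** The left endpoint is the least element of the interval. Injectivity lets a sum over the set of
    intervals be reindexed by words without merging terms. *)
Lemma ladic_interval_inj (R : realType) l n :
  (0 < l)%N -> injective (@ladic_interval R l n).
Proof.
move=> l0 v w vw; apply: (@ladic_left_inj R).
have left (u : n.-tuple 'I_l) : ladic_interval u (ladic_left R u).
  rewrite /ladic_interval /= in_itv /= lexx/= ltrDl invr_gt0 exprn_gt0//.
  by rewrite ltr0n.
apply/eqP; rewrite eq_le; apply/andP; split.
  by have := left w; rewrite -vw /ladic_interval /= in_itv /= => /andP[].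
by have := left v; rewrite vw /ladic_interval /= in_itv /= => /andP[].
Qed.

Lemma sum_ladic_family (R : realType) l n (F : set R -> R) : (0 < l)%N ->
  \sum_(I \in ladic_family R l n) F I =
  \sum_(w : n.-tuple 'I_l) F (ladic_interval w).
Proof.
move=> l0; rewrite /ladic_family fsbig_image; last first.
  by move=> v w _ _; exact: ladic_interval_inj.
rewrite (fsbigE (enum {: n.-tuple 'I_l})) ?enum_uniq//.
  by rewrite big_enum_cond/=; apply: eq_bigl => w; rewrite in_setT.
by move=> w _; rewrite mem_enum.
Qed.

(** * Perron-Frobenius and the growth of the structure sums *)

(** A positive entry of a power comes from a path through positive entries, and such a path survives
    in [A]. This passes irreducibility from [P] to [P_q]. *)
Lemma irreducible_matrix_support (R : realType) l (P A : 'M[R]_l) :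
  (forall i j, 0 <= P i j) -> (forall i j, 0 <= A i j) ->
  (forall i j, 0 < P i j -> 0 < A i j) ->
  irreducible_matrix P -> irreducible_matrix A.
Proof.
move=> P0 A0 PA irr i j; have [n n1 Pn] := irr i j; exists n => //.
elim: n i {n1} Pn => [|n IH] i; first by rewrite !expr0 !mxE.
rewrite !exprS !mxE => Pn.
have [k Pk] : exists k, 0 < P i k * (P ^+ n) k j.
  apply: contrapT => /forallNP PkN; move: Pn.
  by rewrite ltNge sumr_le0// => k _; rewrite leNgt; exact/negP/PkN.
have Pn0 := exprmx_ge0 n P0 k j.
have Pnk : 0 < (P ^+ n) k j.
  by rewrite lt0r Pn0 andbT; apply: contraTneq Pk => ->; rewrite mulr0 ltxx.
have An0 := exprmx_ge0 n A0.
rewrite (bigD1 k)//= ltr_wpDr ?sumr_ge0// => [h _|]; first by rewrite mulr_ge0.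
by rewrite mulr_gt0 ?IH// PA// -(pmulr_lgt0 _ Pnk).
Qed.

Lemma irreducible_matrix_tr (R : realType) l (A : 'M[R]_l) :
  irreducible_matrix A -> irreducible_matrix A^T.
Proof.
move=> irr i j; have [n n1 An] := irr j i; exists n => //.
suff -> : A^T ^+ n = (A ^+ n)^T by rewrite mxE.
elim: n {n1 An} => [|n IH]; first by rewrite !expr0 trmx1.
by rewrite exprS exprSr IH; exact/esym/trmx_mul.
Qed.

Lemma perron_frobenius (R : realType) l (A : 'M[R]_l) :
  (0 < l)%N -> (forall i j, 0 <= A i j) -> irreducible_matrix A ->
  0 < spectral_radius A /\
  exists2 u : 'cV[R]_l, forall i, 0 < u i 0 & A *m u = spectral_radius A *: u.
Proof.
move=> l0 A0 irr.
have [x [r [r0 x0 xA]]] := perron_left l0 A0 irr.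
have [|v [s [s0 v0 vA]]] := perron_left l0 _ (irreducible_matrix_tr irr).
  by move=> i j; rewrite mxE.
have Au : A *m v^T = s *: v^T by rewrite -[A]trmxK -trmx_mul vA linearZ.
have xv : 0 < (x *m v^T) 0 0.
  rewrite mxE (bigD1 (Ordinal l0))//= ltr_wpDr//; last by rewrite mxE mulr_gt0.
  by rewrite sumr_ge0// => i _; rewrite mxE mulr_ge0// ltW.
(* Evaluating [x A v^T] in two ways gives [r (x v^T) = s (x v^T)] with [x v^T > 0]. *)
have rs : r = s.
  apply: (mulIf (lt0r_neq0 xv)).
  have : (x *m A *m v^T) 0 0 = (x *m (A *m v^T)) 0 0 by rewrite mulmxA.
  by rewrite xA Au -scalemxAl -scalemxAr !mxE.
have -> : spectral_radius A = r.
  apply: (@spectral_radius_eq _ _ A x (v 0)) => //; last exact: ltW.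
  - by move=> i; have /colP/(_ i) := Au; rewrite !mxE rs => <-;
      apply: eq_bigr => j _; rewrite mxE.
  - by apply/rV0Pn; exists (Ordinal l0); rewrite gt_eqF.
split=> //; exists v^T; first by move=> i; rewrite mxE.
by rewrite rs.
Qed.

Lemma sum_mulmx_exp_bounds (R : realType) l (A : 'M[R]_l) (a : 'rV[R]_l)
    (u : 'cV[R]_l) r :
  (forall i j, 0 <= A i j) -> (forall i, 0 <= a 0 i) -> a != 0 ->
  (forall i, 0 < u i 0) -> A *m u = r *: u ->
  exists c C : R, [/\ 0 < c, 0 < C &
    forall n, c * r ^+ n <= \sum_j (a *m A ^+ n) 0 j <= C * r ^+ n].
Proof.
move=> A0 a0 an0 u0 Au.
(* The two bounds give [d u_j <= 1 <= e^-1 u_j], which compares the plain sum of [a A^n] with its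
   pairing against [u], equal to [r^n (a u)]. *)
have [e e0 eu] := finite_pos_lower_bound u0.
have [|d d0 du] := @finite_pos_lower_bound R _ (fun i => (u i 0)^-1).
  by move=> i; rewrite invr_gt0.
have au0 : 0 < (a *m u) 0 0.
  have /rV0Pn[k ak] := an0; rewrite mxE (bigD1 k)//= ltr_wpDr//.
    by rewrite sumr_ge0// => i _; rewrite mulr_ge0// ltW.
  by rewrite mulr_gt0// lt0r ak a0.
have Anu n : A ^+ n *m u = r ^+ n *: u.
  elim: n => [|n IH]; first by rewrite !expr0 mul1mx scale1r.
  by rewrite exprSr -mulmxA Au -scalemxAr IH scalerA exprS.
have aA0 n j : 0 <= (a *m A ^+ n) 0 j.
  by rewrite mxE sumr_ge0// => i _; rewrite mulr_ge0// exprmx_ge0.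
have sE n : \sum_j (a *m A ^+ n) 0 j * u j 0 = (a *m u) 0 0 * r ^+ n.
  have : (a *m A ^+ n *m u) 0 0 = (r ^+ n *: (a *m u)) 0 0.
    by rewrite -mulmxA Anu scalemxAr.
  by rewrite mxE => ->; rewrite mxE mulrC.
exists (d * (a *m u) 0 0), (e^-1 * (a *m u) 0 0); split; rewrite ?mulr_gt0 ?invr_gt0//.
move=> n; rewrite -!mulrA -sE !mulr_sumr; apply/andP; split.
  apply: ler_sum => j _; rewrite mulrCA ler_piMr//.
  by rewrite -ler_pdivlMr// div1r.
apply: ler_sum => j _; rewrite mulrCA ler_peMr//.
by rewrite ler_pdivlMl// mulr1.
Qed.

Lemma cvg_mean_ln (R : realType) (S : R^nat) (c C r : R) :
  0 < c -> 0 < C -> 0 < r ->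
  (forall n, c * r ^+ n <= S n <= C * r ^+ n) ->
  n.+1%:R^-1 * ln (S n) @[n --> \oo] --> ln r.
Proof.
move=> c0 C0 r0 Sb.
have lnb k n : 0 < k -> ln (k * r ^+ n) = ln k + n%:R * ln r.
  by move=> k0; rewrite lnM ?posrE ?exprn_gt0// lnXn// mulr_natl.
have lim (k : R) : n.+1%:R^-1 * (ln k + n%:R * ln r) @[n --> \oo] --> ln r.
  (* The factor is [1/(n+1)] but the exponent is [n]; the mismatch and the constant [k] together
     contribute only a multiple of [1/(n+1)]. *)
  have -> : (fun n => n.+1%:R^-1 * (ln k + n%:R * ln r)) =
      (fun n => ln r + (ln k - ln r) * harmonic n).
    apply/funext => n; rewrite /harmonic /=.
    have n0 : n.+1%:R != 0 :> R by rewrite pnatr_eq0.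
    have -> : n%:R = n.+1%:R - 1 :> R by rewrite -natr1 addrK.
    by field.
  rewrite -[X in _ --> X]addr0; apply: cvgD; first exact: cvg_cst.
  rewrite -(mulr0 (ln k - ln r)).
  by apply: cvgM; [exact: cvg_cst|exact: cvg_harmonic].
apply: (squeeze_cvgr _ (lim c) (lim C)); apply: nearW => n.
have /andP[cS SC] := Sb n.
have cr0 : 0 < c * r ^+ n by rewrite mulr_gt0// exprn_gt0.
have S0 := lt_le_trans cr0 cS.
by rewrite -!lnb// !ler_wpM2l ?invr_ge0// ler_ln ?posrE// (lt_le_trans S0).
Qed.

Theorem theorem3p2 (R : realType) (l : nat) (p : 'rV[R]_l) (P : 'M[R]_l)
    (m : probability (measurableTypeR R) R)
    (hl : (2 <= l)%N)
    (hp : probability_vector p)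
    (hP : stochastic_matrix P)
    (hP1 : forall i j, P i j != 1)
    (hm : driven_by m p P)
    (hirr : irreducible_matrix P) :
  forall q : R,
    structure_function l m q =
      (logb l%:R (spectral_radius (map_mx (fun x => pow0R x q) P)))%:E
    /\ (structure_seq l m q n)%:E @[n --> \oo] --> structure_function l m q.
Proof.
move=> q; set A := map_mx _ P; set r := spectral_radius A.
have [p0 p1] := hp; have [P0 _] := hP; have [_ mw] := hm.
have l0 : (0 < l)%N := ltnW hl.
pose a := map_mx (fun x => pow0R x q) p.
have A0 i j : 0 <= A i j by rewrite mxE pow0R_ge0.
have a0 i : 0 <= a 0 i by rewrite mxE pow0R_ge0.
(* Some [p_k] is positive since the sum is 1, and [pow0R] keeps it positive for every [q]. *)
have an0 : a != 0.
  have /rV0Pn[k pk] : p != 0.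
    by apply: contra_eq_neq p1 => ->; rewrite big1 ?(eq_sym 0) ?oner_neq0// => i _; rewrite mxE.
  by apply/rV0Pn; exists k; rewrite mxE gt_eqF// pow0R_gt0// lt0r pk p0.
have irrA : irreducible_matrix A.
  by apply: irreducible_matrix_support hirr => // i j Pij; rewrite mxE pow0R_gt0.
have [r0 [u u0 Au]] := perron_frobenius l0 A0 irrA.
have [c [C [c0 C0 Sb]]] := sum_mulmx_exp_bounds A0 a0 an0 u0 Au.
have cvg : (structure_seq l m q n)%:E @[n --> \oo] --> (logb l%:R r)%:E.
  apply: cvg_EFin; first exact: nearW.
  (* Dropping the index 0 leaves words of length [n.+1], which have [n] transitions and so
     correspond to [A ^+ n]. *)
  rewrite -cvg_shiftS /logb.
  have -> : [sequence structure_seq l m q n.+1]_n =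
      (fun n => n.+1%:R^-1 * ln (\sum_j (a *m A ^+ n) 0 j) * (ln l%:R)^-1).
    apply/funext => n; rewrite /structure_seq /= sum_ladic_family// invfM mulrAC.
    congr (_ * ln _ * _); rewrite -sum_word_weight; apply: eq_bigr => w _.
    by rewrite mw pow0R_word_weight.
  by apply: cvgM; [exact: cvg_mean_ln Sb|exact: cvg_cst].
have [_ esup] := cvg_limn_einf_sup cvg.
by rewrite /structure_function esup.
Qed.
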